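(* The Euler–Mascheroni constant $\gamma$ satisfies $$-\gamma=\sum_{n=1}^{\infty}\frac{L_n(1)}{n}=-\frac14-\frac29-\frac{5}{32}+\cdots,$$ where the displayed numerical terms are those for $n=2,3,4$ (the $n=1$ term is $0$).
   Context: $L_n(1)$ is the value at $1$ of the Laguerre polynomial $L_n(x)=\sum_{k=0}^{n}\binom{n}{k}\frac{(-1)^k}{k!}x^k$, so $L_n(1)=\sum_{k=0}^{n}\binom{n}{k}\frac{(-1)^k}{k!}$. The infinite series is understood as the limit of its partial sums. *)

(* Defs.v *)
From Stdlib Require Import Reals Factorial Lra Lia.
From Coquelicot Require Import Coquelicot.

Open Scope R_scope.

Definition Laguerre (n : nat) (x : R) : R :=
  sum_n (fun k => Binomial.C n k * ((-1) ^ k / INR (fact k)) * x ^ k) n.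

Definition harmonic (n : nat) : R := sum_n_m (fun k => / INR k) 1 n.

Definition Euler_gamma : R := Lim_seq (fun n => harmonic n - ln (INR n)).

Lemma ln_le_sub1 (x : R) : 0 < x -> ln x <= x - 1.
Proof.
intros Hx.
pose proof (exp_ineq1_le (ln x)) as H.
rewrite exp_ln in H; lra.
Qed.

Lemma harmonic_S (n : nat) : harmonic (S n) = harmonic n + / INR (S n).
Proof.
unfold harmonic.
rewrite sum_n_Sm by lia.
reflexivity.
Qed.

Lemma ln_le_harmonic (n : nat) : ln (INR (S n)) <= harmonic n.
Proof.
induction n as [|n IH].
- unfold harmonic. rewrite sum_n_m_zero by lia.
  change (ln 1 <= 0). rewrite ln_1. lra.
- rewrite harmonic_S.
  assert (H1 : 0 < INR (S n)) by (apply lt_0_INR; lia).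
  assert (H2 : 0 < INR (S (S n))) by (apply lt_0_INR; lia).
  pose proof (ln_le_sub1 (INR (S (S n)) / INR (S n))
                (Rdiv_lt_0_compat _ _ H2 H1)) as H.
  rewrite ln_div in H by assumption.
  replace (INR (S (S n)) / INR (S n) - 1) with (/ INR (S n)) in H
    by (rewrite (S_INR (S n)); field; lra).
  lra.
Qed.

(* [Lim_seq] is total, so existence of a finite limit must be checked for
   [Euler_gamma] to be meaningful. *)
Lemma Euler_gamma_correct :
  is_lim_seq (fun n => harmonic n - ln (INR n)) Euler_gamma.
Proof.
apply Lim_seq_correct'.
enough (H : ex_finite_lim_seq
              (fun n => harmonic (S n) - ln (INR (S n)))).
{ destruct H as [l Hl]. exists l.
  apply (is_lim_seq_incr_1 (fun n => harmonic n - ln (INR n))).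
  exact Hl. }
apply ex_finite_lim_seq_decr with 0.
- intros n.
  rewrite (harmonic_S (S n)).
  assert (H1 : 0 < INR (S n)) by (apply lt_0_INR; lia).
  assert (H2 : 0 < INR (S (S n))) by (apply lt_0_INR; lia).
  pose proof (ln_le_sub1 (INR (S n) / INR (S (S n)))
                (Rdiv_lt_0_compat _ _ H1 H2)) as H.
  rewrite ln_div in H by assumption.
  replace (INR (S n) / INR (S (S n)) - 1) with (- / INR (S (S n))) in H
    by (rewrite (S_INR (S n)) in *; field; lra).
  lra.
- intros n.
  pose proof (ln_le_harmonic (S n)) as H.
  assert (H1 : 0 < INR (S n)) by (apply lt_0_INR; lia).
  assert (H2 : ln (INR (S n)) <= ln (INR (S (S n)))).
  { apply ln_le; [assumption | apply le_INR; lia]. }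
  lra.
Qed.

(* Main.v *)
Require Import Defs.
From Stdlib Require Import Reals Factorial Lra Lia.
From Coquelicot Require Import Coquelicot.
Open Scope R_scope.

(** Write [l n] for the value at [1] of the [n]-th Laguerre polynomial.

    The generating function of [l] is [G t = exp (- t / (1 - t)) / (1 - t)], so
    the series of [l n / n] at [t < 1] is the integral of [(G - 1) / t].  The
    substitution [t = s / (s + 1)] turns it into [ln (s + 1)] minus the integral
    of [(1 - exp (- u)) / u] from [0] to [s].  Comparing [exp (- u)] with
    [(1 - u / N) ^ N], whose analogous integral up to [N] is the [N]-th harmonic
    number, places its value at [s = N] within [1 / N] of [ln (N + 1)] minus that
    harmonic number ([divided_gf_bounds]).  Hence the series is Abel summable to
    [- Euler_gamma].

    Ordinary convergence then follows from Tauber's theorem ([tauber]), whose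
    hypothesis that [n] times the [n]-th term tends to zero is [l n --> 0].  This
    comes from an energy estimate on the recurrence of the Laguerre polynomials
    ([laguerre_system_lim]), a discrete form of the decay of solutions of
    [x y'' + y' + y = 0]. *)

(** * The Laguerre recurrence *)

Lemma sum_n_Rmult_l c (f : nat -> R) n :
  sum_n (fun k => c * f k) n = c * sum_n f n.
Proof. exact (sum_n_mult_l (K := R_Ring) c f n). Qed.

Lemma sum_n_Rplus (f g : nat -> R) n :
  sum_n (fun k => f k + g k) n = sum_n f n + sum_n g n.
Proof. exact (sum_n_plus (G := R_AbelianMonoid) f g n). Qed.

Lemma sum_n_RS (f : nat -> R) n : sum_n f (S n) = sum_n f n + f (S n).
Proof. exact (sum_Sn (G := R_AbelianMonoid) f n). Qed.

Lemma sum_n_Rext (f g : nat -> R) n :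
  (forall k, (k <= n)%nat -> f k = g k) -> sum_n f n = sum_n g n.
Proof. exact (sum_n_ext_loc (G := R_AbelianMonoid) f g n). Qed.

(** The factorial quotient [Binomial.C n k] takes nonzero values for [n < k];
    extended by zero it satisfies Pascal's rule everywhere, so that sums for
    different [n] can share one range. *)
Definition binomial (n k : nat) : R :=
  if (k <=? n)%nat then Binomial.C n k else 0.

Lemma binomial_0_r n : binomial n 0 = 1.
Proof. exact (C_n_0 n). Qed.

Lemma binomial_gt n k : (n < k)%nat -> binomial n k = 0.
Proof.
intros H. unfold binomial. destruct (Nat.leb_spec k n); [lia | reflexivity].
Qed.

Lemma binomial_SS n k : binomial (S n) (S k) = binomial n k + binomial n (S k).
Proof.
unfold binomial. change (S k <=? S n)%nat with (k <=? n)%nat.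
destruct (Nat.leb_spec k n); destruct (Nat.leb_spec (S k) n); try lia.
- symmetry. apply pascal. lia.
- replace k with n by lia. rewrite !C_n_n. lra.
- lra.
Qed.

Lemma binomial_absorb n k :
  INR (S n) * binomial n k = INR (S k) * binomial (S n) (S k).
Proof.
unfold binomial. change (S k <=? S n)%nat with (k <=? n)%nat.
destruct (Nat.leb_spec k n); [| lra].
unfold Binomial.C. replace (S n - S k)%nat with (n - k)%nat by lia.
rewrite (fact_simpl n), (fact_simpl k), !mult_INR.
field; repeat split; try apply INR_fact_neq_0; apply not_0_INR; lia.
Qed.

Definition laguerre_weight (x : R) (k : nat) : R :=
  (-1) ^ k / INR (fact k) * x ^ k.

Lemma laguerre_weight_S x k :
  INR (S k) * laguerre_weight x (S k) = - x * laguerre_weight x k.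
Proof.
unfold laguerre_weight. rewrite fact_simpl, mult_INR. simpl pow.
field. split; [apply INR_fact_neq_0 | apply not_0_INR; lia].
Qed.

Lemma Laguerre_binomial n m x : (n <= m)%nat ->
  Laguerre n x = sum_n (fun k => binomial n k * laguerre_weight x k) m.
Proof.
intros H. induction H as [|m H IH].
- apply sum_n_Rext. intros k Hk.
  unfold binomial, laguerre_weight. destruct (Nat.leb_spec k n); [ring | lia].
- rewrite sum_n_RS, <- IH, binomial_gt by lia. ring.
Qed.

(** This is [x] times the derivative of the [n]-th Laguerre polynomial.  It also
    equals [n * (Laguerre n x - Laguerre (n - 1) x)], and it is the variable
    that turns the three-term recurrence into a first-order system. *)
Definition laguerre_diff (n : nat) (x : R) : R :=
  sum_n (fun k => INR k * binomial n k * laguerre_weight x k) n.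

Lemma sum_n_drop0 (f : nat -> R) n : f 0%nat = 0 ->
  sum_n f (S n) = sum_n (fun k => f (S k)) n.
Proof.
intros H. induction n as [|n IH].
- rewrite sum_n_RS, !sum_O, H. apply Rplus_0_l.
- rewrite sum_n_RS, IH. symmetry. apply (sum_n_RS (fun k => f (S k))).
Qed.

(** By Pascal's rule, raising [n] adds [k * binomial n (k - 1)] times the
    [k]-th weight, and [k] times that weight is [- x] times the previous one. *)
Lemma laguerre_diff_S n x :
  laguerre_diff (S n) x = laguerre_diff n x - x * Laguerre n x.
Proof.
assert (E : laguerre_diff n x
  = sum_n (fun k => INR k * binomial n k * laguerre_weight x k) (S n)).
{ rewrite sum_n_RS, binomial_gt by lia. fold (laguerre_diff n x). ring. }
rewrite E, (Laguerre_binomial n n) by lia.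
unfold laguerre_diff. rewrite !sum_n_drop0 by (simpl; ring).
unfold Rminus. rewrite Ropp_mult_distr_l, <- sum_n_Rmult_l, <- sum_n_Rplus.
apply sum_n_Rext. intros k _. rewrite binomial_SS.
replace (- x * (binomial n k * laguerre_weight x k))
  with (binomial n k * (- x * laguerre_weight x k)) by ring.
rewrite <- laguerre_weight_S. ring.
Qed.

(** Pascal's rule leaves [binomial n (k - 1)] in the difference, and the
    absorption identity turns [(n + 1) * binomial n (k - 1)] into
    [k * binomial (n + 1) k]. *)
Lemma Laguerre_S n x :
  INR (S n) * (Laguerre (S n) x - Laguerre n x) = laguerre_diff (S n) x.
Proof.
rewrite (Laguerre_binomial (S n) (S n)), (Laguerre_binomial n (S n)) by lia.
unfold Rminus, laguerre_diff.
replace (- sum_n (fun k => binomial n k * laguerre_weight x k) (S n))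
  with (-1 * sum_n (fun k => binomial n k * laguerre_weight x k) (S n)) by ring.
rewrite <- sum_n_Rmult_l, <- sum_n_Rplus, <- sum_n_Rmult_l.
rewrite !sum_n_drop0 by (rewrite ?binomial_0_r; simpl; ring).
apply sum_n_Rext. intros k _.
rewrite <- binomial_absorb, binomial_SS. ring.
Qed.

Lemma Laguerre_0 x : Laguerre 0 x = 1.
Proof.
unfold Laguerre. rewrite sum_O, C_n_0. simpl. field.
Qed.

Lemma laguerre_diff_0 x : laguerre_diff 0 x = 0.
Proof. unfold laguerre_diff. rewrite sum_O. simpl. ring. Qed.

(** The first-order system satisfied at [x = 1] by the values of the Laguerre
    polynomials and their scaled differences; the asymptotic and generating
    function arguments use nothing else. *)
Definition laguerre_system (l d : nat -> R) : Prop :=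
  forall n, d (S n) = d n - l n /\ INR (S n) * (l (S n) - l n) = d (S n).

Lemma Laguerre_system_1 :
  laguerre_system (fun n => Laguerre n 1) (fun n => laguerre_diff n 1).
Proof.
intros n. split; [| apply Laguerre_S].
rewrite laguerre_diff_S. ring.
Qed.

(** * Decay of the values at 1 *)

(** The system discretizes [x y'' + y' + y = 0], with [l] for [y] and [d] for
    [x y'].  The natural energy [d ^ 2 + x l ^ 2] has derivative [l ^ 2], which
    only bounds [l].  Subtracting [l d / 2] averages the kinetic and the potential
    part: the derivative becomes half of [l ^ 2 + d ^ 2 / x], about
    [energy / (2 x)], so that the energy grows like the square root of [x]. *)
Definition energy (l d : nat -> R) (n : nat) : R :=
  d n ^ 2 + INR n * l n ^ 2 - l n * d n / 2.

Lemma energy_ge l d n : (1 <= n)%nat ->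
  d n ^ 2 + INR n * l n ^ 2 <= 2 * energy l d n.
Proof.
intros H. apply le_INR in H. simpl in H. unfold energy.
pose proof (pow2_ge_0 (d n - l n)). pose proof (pow2_ge_0 (l n)).
pose proof (pow2_ge_0 (d n)). nra.
Qed.

Lemma energy_S l d n : laguerre_system l d ->
  energy l d (S n) = energy l d n + (d (S n) ^ 2 / INR (S n) + l n ^ 2) / 2.
Proof.
intros Hsys. destruct (Hsys n) as [Hd Hl].
assert (0 < INR (S n)) by (apply lt_0_INR; lia).
assert (E : l (S n) = l n + d (S n) / INR (S n)).
{ rewrite <- Hl. field. lra. }
unfold energy. rewrite E, Hd. rewrite S_INR in *. field. lra.
Qed.

(** Any factor [1 + c / n] with [c < 1] makes [energy / n] tend to zero, and
    [c = 3 / 5] leaves room above the asymptotic [c = 1 / 2] for the error terms: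
    the bound reduces to non-negativity of a quadratic form in [d n] and [l n],
    whose discriminant condition [4 * (n - 5) >= 49] holds from [n = 18] on. *)
Lemma energy_growth l d n : laguerre_system l d -> (18 <= n)%nat ->
  energy l d (S n) <= (1 + 3 / 5 / INR n) * energy l d n.
Proof.
intros Hsys Hn. rewrite (energy_S l d n Hsys), (proj1 (Hsys n)).
assert (18 <= INR n) by (apply le_INR in Hn; simpl in Hn; lra).
assert (H1 : (d n - l n) ^ 2 / INR (S n) <= (d n - l n) ^ 2 / INR n).
{ apply Rmult_le_compat_l; [apply pow2_ge_0 |].
  apply Rinv_le_contravar; rewrite ?S_INR; lra. }
enough ((d n - l n) ^ 2 + INR n * l n ^ 2 <= 6 / 5 * energy l d n) as H2.
{ apply (Rmult_le_compat_r (/ INR n)) in H2;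
    [| left; apply Rinv_0_lt_compat; lra].
  replace (((d n - l n) ^ 2 + INR n * l n ^ 2) * / INR n)
    with ((d n - l n) ^ 2 / INR n + l n ^ 2) in H2 by (field; lra).
  replace (3 / 5 / INR n) with (6 / 5 * / INR n / 2) by (field; lra). nra. }
unfold energy. pose proof (pow2_ge_0 (d n + 7 / 2 * l n)).
pose proof (pow2_ge_0 (l n)). nra.
Qed.

(** Cubing avoids real exponents: [(1 + 3 / 5 * a) ^ 3 <= (1 + a) ^ 2] for
    [0 < a <= 1 / 2], so that [energy ^ 3 / n ^ 2] does not increase. *)
Lemma energy_cube_bound l d n : laguerre_system l d -> (18 <= n)%nat ->
  energy l d n ^ 3 <= energy l d 18 ^ 3 * INR n ^ 2.
Proof.
intros Hsys.
assert (HF : forall n, (18 <= n)%nat -> 0 <= energy l d n).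
{ intros m Hm. pose proof (energy_ge l d m ltac:(lia)). pose proof (pos_INR m).
  pose proof (pow2_ge_0 (l m)). pose proof (pow2_ge_0 (d m)). nra. }
intros Hn. induction Hn as [|n Hn IH].
- pose proof (pow_le _ 3 (HF 18%nat ltac:(lia))).
  replace (INR 18) with 18 by (simpl; lra). lra.
- assert (18 <= INR n) by (apply le_INR in Hn; simpl in Hn; lra).
  set (a := / INR n).
  assert (Ha : 0 < a) by (apply Rinv_0_lt_compat; lra).
  assert (Ha1 : a <= / 2).
  { unfold a. apply Rinv_le_contravar; lra. }
  apply Rle_trans with (((1 + 3 / 5 * a) * energy l d n) ^ 3).
  { apply pow_incr. split; [apply HF; lia |].
    exact (energy_growth l d n Hsys Hn). }
  rewrite Rpow_mult_distr.
  assert (H3 : (1 + 3 / 5 * a) ^ 3 <= (1 + a) ^ 2) by nra.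
  replace (INR (S n)) with ((1 + a) * INR n)
    by (unfold a; rewrite S_INR; field; lra).
  rewrite Rpow_mult_distr.
  pose proof (pow_le _ 3 (HF n Hn)).
  pose proof (pow2_ge_0 (1 + a)).
  apply Rle_trans with ((1 + a) ^ 2 * energy l d n ^ 3).
  { now apply Rmult_le_compat_r. }
  replace (energy l d 18 ^ 3 * ((1 + a) ^ 2 * INR n ^ 2))
    with ((1 + a) ^ 2 * (energy l d 18 ^ 3 * INR n ^ 2)) by ring.
  now apply Rmult_le_compat_l.
Qed.

(** The energy dominates [n * l n ^ 2] and is [O(n ^ (2 / 3))], which gives
    [l n ^ 6 = O(1 / n)]. *)
Lemma laguerre_system_lim l d : laguerre_system l d -> is_lim_seq l 0.
Proof.
intros Hsys.
assert (Hinv : is_lim_seq (fun n => (8 * energy l d 18 ^ 3) * / INR n) 0).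
{ replace (Finite 0) with (Rbar_mult (8 * energy l d 18 ^ 3) 0)
    by (simpl; now rewrite Rmult_0_r).
  apply is_lim_seq_scal_l.
  apply (is_lim_seq_inv _ p_infty); [apply is_lim_seq_INR | discriminate]. }
apply is_lim_seq_spec in Hinv. apply is_lim_seq_spec. intros eps.
assert (He : 0 < eps ^ 6) by (apply pow_lt, cond_pos).
destruct (Hinv (mkposreal _ He)) as [N HN]. simpl in HN.
exists (N + 18)%nat. intros n Hn.
specialize (HN n ltac:(lia)).
assert (Hn18 : (18 <= n)%nat) by lia.
assert (18 <= INR n) by (apply le_INR in Hn18; simpl in Hn18; lra).
rewrite Rminus_0_r in *. apply Rnot_le_lt. intros Hge.
assert (H6 : eps ^ 6 <= (l n ^ 2) ^ 3).
{ rewrite <- pow_mult.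
  replace (l n ^ (2 * 3)) with (Rabs (l n) ^ 6)
    by (rewrite RPow_abs, Rabs_pos_eq;
        [reflexivity | replace (l n ^ 6) with ((l n ^ 3) ^ 2) by ring;
                       apply pow2_ge_0]).
  apply pow_incr. split; [left; apply cond_pos | exact Hge]. }
assert (H7 : (INR n * l n ^ 2) ^ 3 <= (2 * energy l d n) ^ 3).
{ apply pow_incr. pose proof (pow2_ge_0 (l n)). pose proof (pow2_ge_0 (d n)).
  pose proof (energy_ge l d n ltac:(lia)). split; nra. }
pose proof (energy_cube_bound l d n Hsys Hn18) as H8.
rewrite !Rpow_mult_distr in H7.
assert (H9 : (l n ^ 2) ^ 3 <= 8 * energy l d 18 ^ 3 * / INR n).
{ apply (Rmult_le_reg_l (INR n ^ 3)); [apply pow_lt; lra |].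
  replace (INR n ^ 3 * (8 * energy l d 18 ^ 3 * / INR n))
    with (8 * (energy l d 18 ^ 3 * INR n ^ 2)) by (field; lra). lra. }
pose proof (Rle_abs (8 * energy l d 18 ^ 3 * / INR n)).
simpl in *. lra.
Qed.

(** * Tauber's theorem *)

Lemma one_minus_pow_bound t n : 0 <= t <= 1 -> 0 <= 1 - t ^ n <= INR n * (1 - t).
Proof.
intros Ht. induction n as [|n IH]; [simpl; lra |].
rewrite S_INR. simpl pow. nra.
Qed.

Lemma CV_radius_of_bounded a t :
  (exists M, forall n, Rabs (a n) <= M) -> Rabs t < 1 ->
  Rbar_lt (Rabs t) (CV_radius a).
Proof.
intros [M HM] Ht. apply Rbar_lt_le_trans with 1; [exact Ht |].
apply CV_radius_bounded. exists M. intros n. rewrite pow1, Rmult_1_r. apply HM.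
Qed.

Lemma is_lim_seq_bounded (a : nat -> R) (l : R) : is_lim_seq a l ->
  exists M, forall n, Rabs (a n) <= M.
Proof.
intros H.
pose proof (proj1 (is_lim_seq_Reals a l) H) as Hu.
destruct (maj_by_pos a (exist _ l Hu)) as [M [_ HM]]. exists M. exact HM.
Qed.

(** At [t = N / (N + 1)] the partial sum up to [N] differs from the value of
    the power series by at most the mean of [n * |a n|] over [n <= N], because
    [1 - t ^ n <= n * (1 - t)], plus the supremum of [n * |a n|] over [n > N],
    because there [1 / n <= 1 / (N + 1)] and the powers of [t] sum to at most
    [N + 1].  The means tend to zero with the terms, by Cesaro. *)
Theorem tauber (a : nat -> R) (l : R) :
  is_lim_seq (fun n => INR n * a n) 0 ->
  is_lim_seq (fun N => PSeries a (INR N / INR (S N))) l ->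
  is_series a l.
Proof.
intros H0 HA.
set (c := fun n => Rabs (INR n * a n)).
assert (Hc : is_lim_seq c 0)
  by (apply (is_lim_seq_abs_0 (fun n => INR n * a n)); exact H0).
assert (Hces : is_lim_seq (fun N => sum_n c N / INR (S N)) 0).
{ pose proof (Cesaro_1 c 0 (proj1 (is_lim_seq_Reals _ _) Hc)) as H.
  apply is_lim_seq_Reals, is_lim_seq_incr_1 in H.
  revert H. apply is_lim_seq_ext. intros N. now rewrite sum_n_Reals. }
assert (Hrad : forall t, Rabs t < 1 -> Rbar_lt (Rabs t) (CV_radius a)).
{ intros t. apply CV_radius_of_bounded.
  destruct (is_lim_seq_bounded _ _ H0) as [M HM].
  exists (Rmax M (Rabs (a 0%nat))). intros [|n]; [apply Rmax_r |].
  apply Rle_trans with M; [| apply Rmax_l].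
  apply Rle_trans with (2 := HM (S n)).
  rewrite Rabs_mult, (Rabs_pos_eq (INR _)) by apply pos_INR.
  rewrite S_INR. pose proof (Rabs_pos (a (S n))). pose proof (pos_INR n). nra. }
assert (Hdiff : is_lim_seq
  (fun N => sum_n a N - PSeries a (INR N / INR (S N))) 0).
{ apply is_lim_seq_spec. intros eps.
  apply is_lim_seq_spec in Hc. apply is_lim_seq_spec in Hces.
  destruct (Hc (pos_div_2 eps)) as [N1 HN1].
  destruct (Hces (pos_div_2 eps)) as [N2 HN2].
  exists (N1 + N2)%nat. intros N HN. rewrite Rminus_0_r.
  specialize (HN2 N ltac:(lia)). rewrite Rminus_0_r in HN2.
  pose proof (Rle_abs (sum_n c N / INR (S N))) as HN2'.
  assert (HSN : 0 < INR (S N)) by (apply lt_0_INR; lia).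
  set (t := INR N / INR (S N)).
  assert (Ht1 : 1 - t = / INR (S N)).
  { unfold t. rewrite S_INR in *. field. lra. }
  assert (Hi : 0 < / INR (S N)) by now apply Rinv_0_lt_compat.
  assert (Ht : 0 <= t < 1).
  { split; [apply Rdiv_le_0_compat; [apply pos_INR | exact HSN] | lra]. }
  assert (Hta : Rabs t < 1) by (rewrite Rabs_pos_eq; lra).
  pose proof (CV_disk_inside a t (Hrad t Hta)) as Habs.
  pose proof (ex_series_Rabs _ Habs) as Hex.
  assert (Hsplit : PSeries a t = sum_n (fun n => a n * t ^ n) N
    + Series (fun k => a (S N + k)%nat * t ^ (S N + k))).
  { unfold PSeries. rewrite (Series_incr_n _ (S N)) by (lia || exact Hex).
    now rewrite sum_n_Reals. }
  rewrite Hsplit.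
  assert (Hhead : Rabs (sum_n a N - sum_n (fun n => a n * t ^ n) N)
                  <= sum_n c N / INR (S N)).
  { replace (sum_n a N - sum_n (fun n => a n * t ^ n) N)
      with (sum_n (fun n => a n * (1 - t ^ n)) N).
    2:{ rewrite !sum_n_Reals, <- minus_sum. apply sum_eq. intros; ring. }
    unfold Rdiv. rewrite !sum_n_Reals, <- Ht1, Rmult_comm, scal_sum.
    apply Rle_trans with (1 := Rsum_abs _ _).
    apply sum_Rle. intros n _. unfold c.
    destruct (one_minus_pow_bound t n) as [Hb1 Hb2]; [lra |].
    rewrite !Rabs_mult, (Rabs_pos_eq (1 - _)), (Rabs_pos_eq (INR n))
      by (try apply pos_INR; lra).
    replace (INR n * Rabs (a n) * (1 - t))
      with (Rabs (a n) * (INR n * (1 - t))) by ring.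
    apply Rmult_le_compat_l; [apply Rabs_pos | exact Hb2]. }
  assert (Htail : Rabs (Series (fun k => a (S N + k)%nat * t ^ (S N + k)))
                  <= eps / 2).
  { pose proof (proj1 (ex_series_incr_n _ (S N)) Habs) as Habs'.
    apply Rle_trans with (1 := Series_Rabs _ Habs').
    assert (Hg : is_series (fun k => eps / 2 / INR (S N) * t ^ k)
                   (eps / 2 / INR (S N) * / (1 - t))).
    { apply (is_series_scal (V := R_NormedModule)), is_series_geom, Hta. }
    replace (eps / 2 / INR (S N) * / (1 - t)) with (eps / 2) in Hg.
    2:{ rewrite Ht1, Rinv_inv. field. apply (not_0_INR (S N)). lia. }
    rewrite <- (is_series_unique _ _ Hg).
    apply Series_le; [| eexists; exact Hg].
    intros k. split; [apply Rabs_pos |].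
    rewrite Rabs_mult, (Rabs_pos_eq (t ^ _)) by (apply pow_le; lra).
    specialize (HN1 (S N + k)%nat ltac:(lia)).
    rewrite Rminus_0_r in HN1. unfold c in HN1. rewrite Rabs_Rabsolu in HN1.
    rewrite Rabs_mult, (Rabs_pos_eq (INR _)) in HN1 by apply pos_INR.
    change (pos (pos_div_2 eps)) with (eps / 2) in HN1.
    assert (Hle : INR (S N) <= INR (S N + k)) by (apply le_INR; lia).
    apply Rmult_le_compat; [apply Rabs_pos | apply pow_le; lra | |].
    - apply (Rmult_le_reg_l (INR (S N))); [exact HSN |].
      replace (INR (S N) * (eps / 2 / INR (S N))) with (eps / 2) by (field; lra).
      apply Rle_trans with (2 := Rlt_le _ _ HN1).
      apply Rmult_le_compat_r; [apply Rabs_pos | exact Hle].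
    - rewrite pow_add. pose proof (pow_le t k ltac:(lra)).
      pose proof (pow_le t (S N) ltac:(lra)).
      destruct (one_minus_pow_bound t (S N)) as [Hb _]; [lra |].
      rewrite <- (Rmult_1_l (t ^ k)) at 2. apply Rmult_le_compat_r; lra. }
  change (pos (pos_div_2 eps)) with (eps / 2) in HN2.
  match goal with |- Rabs (?x - (?y + ?z)) < _ =>
    replace (x - (y + z)) with ((x - y) - z) by ring end.
  apply Rle_lt_trans with (1 := Rabs_triang _ _). rewrite Rabs_Ropp. lra. }
change (is_lim_seq (sum_n a) l).
apply (is_lim_seq_ext (fun N => (sum_n a N - PSeries a (INR N / INR (S N)))
  + PSeries a (INR N / INR (S N)))); [intros; ring |].
replace (Finite l) with (Finite (0 + l)) by (f_equal; ring).
now apply is_lim_seq_plus'.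
Qed.

(** * Harmonic numbers and the exponential integral *)

Lemma nonincreasing_of_derive (f df : R -> R) (a b : R) : a <= b ->
  (forall x, a < x < b -> is_derive f x (df x)) ->
  (forall x, a <= x <= b -> continuity_pt f x) ->
  (forall x, a <= x <= b -> df x <= 0) -> f b <= f a.
Proof.
intros Hab Hd Hc Hn.
destruct (MVT_gen f a b df) as [c [Hc1 Hc2]];
  rewrite ?Rmin_left, ?Rmax_right in * by exact Hab; auto.
specialize (Hn c Hc1). nra.
Qed.


(** This is the integral from [0] to [s] of [(1 - (1 - u / c) ^ N) / u],
    integrated term by term after the geometric sum. *)
Definition harmonic_interp (c : R) (N : nat) (s : R) : R :=
  sum_n_m (fun j => (1 - (1 - s / c) ^ j) / INR j) 1 N.

Lemma harmonic_interp_O c s : harmonic_interp c 0 s = 0.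
Proof. exact (sum_n_m_zero (G := R_AbelianMonoid) _ 1 0 (Nat.lt_0_succ 0)). Qed.

Lemma harmonic_interp_S c N s : harmonic_interp c (S N) s =
  harmonic_interp c N s + (1 - (1 - s / c) ^ S N) / INR (S N).
Proof. unfold harmonic_interp. now rewrite sum_n_Sm by lia. Qed.

Lemma harmonic_interp_0 c N : harmonic_interp c N 0 = 0.
Proof.
induction N as [|N IH].
- apply harmonic_interp_O.
- rewrite harmonic_interp_S, IH, Rdiv_0_l, Rminus_0_r, pow1. unfold Rdiv. ring.
Qed.

Lemma harmonic_interp_diag c N : c <> 0 -> harmonic_interp c N c = harmonic N.
Proof.
intros Hc. apply sum_n_m_ext_loc. intros k Hk.
rewrite Rdiv_diag, Rminus_diag, pow_i by (lia || exact Hc).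
unfold Rdiv. rewrite Rminus_0_r. apply Rmult_1_l.
Qed.

Lemma is_derive_harmonic_interp c N s : c <> 0 -> s <> 0 ->
  is_derive (harmonic_interp c N) s ((1 - (1 - s / c) ^ N) / s).
Proof.
intros Hc Hs. induction N as [|N IH].
- apply (is_derive_ext (fun _ => 0)).
  { intros t. symmetry. apply harmonic_interp_O. }
  replace ((1 - (1 - s / c) ^ 0) / s) with 0 by (simpl; field; exact Hs).
  apply (is_derive_const (V := R_NormedModule)).
- apply (is_derive_ext (fun s => harmonic_interp c N s
                             + (1 - (1 - s / c) ^ S N) / INR (S N))).
  { intros t. symmetry. apply harmonic_interp_S. }
  replace ((1 - (1 - s / c) ^ S N) / s)
    with (plus ((1 - (1 - s / c) ^ N) / s) ((1 - s / c) ^ N / c)).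
  2:{ assert (E : forall p, (1 - p) / s + p / c = (1 - (1 - s / c) * p) / s)
        by (intros p; field; now split).
      apply E. }
  apply (is_derive_plus (V := R_NormedModule)); [exact IH |].
  assert (INR (S N) <> 0) by (apply not_0_INR; lia).
  auto_derive; [exact I |]. change (pred (S N)) with N.
  change (match N with 0%nat => 1 | S _ => INR N + 1 end) with (INR (S N)).
  change (1 + - (s * / c)) with (1 - s / c).
  generalize ((1 - s / c) ^ N). intros p. field. auto.
Qed.

(** The upper bound is the [N]-th power of [1 - x <= exp (- x)] at [x = s / N].  For
    the lower one, [exp s >= (1 + s / N) ^ N] and Bernoulli's inequality for
    [1 - (s / N) ^ 2]. *)
Lemma exp_pow_bounds N s : (1 <= N)%nat -> 0 <= s <= INR N ->
  exp (- s) * (1 - s ^ 2 / INR N) <= (1 - s / INR N) ^ N <= exp (- s).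
Proof.
intros HN Hs. assert (HN0 : 0 < INR N) by (apply lt_0_INR; lia).
assert (Hx : 0 <= s / INR N <= 1).
{ split; [apply Rdiv_le_0_compat; lra |].
  apply (Rmult_le_reg_r (INR N)); [lra |].
  unfold Rdiv. rewrite Rmult_assoc, Rinv_l; lra. }
set (x := s / INR N) in *.
assert (Hsx : s = INR N * x) by (unfold x; field; lra).
assert (Hexp : forall y, exp y ^ N = exp (INR N * y)).
{ intros y. clear. induction N as [|N IH].
  - simpl. now rewrite Rmult_0_l, exp_0.
  - rewrite S_INR. simpl pow. rewrite IH, <- exp_plus. f_equal. ring. }
split.
- apply (Rmult_le_reg_l (exp s)); [apply exp_pos |].
  rewrite <- Rmult_assoc, <- exp_plus, Rplus_opp_r, exp_0, Rmult_1_l.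
  apply Rle_trans with ((1 + x) ^ N * (1 - x) ^ N).
  + rewrite <- Rpow_mult_distr.
    replace (s ^ 2 / INR N) with (INR N * x ^ 2) by (rewrite Hsx; field; lra).
    destruct (one_minus_pow_bound (1 - x ^ 2) N) as [_ H]; [nra |].
    replace ((1 + x) * (1 - x)) with (1 - x ^ 2) by ring. lra.
  + apply Rmult_le_compat_r; [apply pow_le; lra |].
    rewrite Hsx, <- Hexp. apply pow_incr.
    pose proof (exp_ineq1_le x). lra.
- replace (- s) with (INR N * - x) by (rewrite Hsx; ring).
  rewrite <- Hexp. apply pow_incr. pose proof (exp_ineq1_le (- x)). lra.
Qed.

Lemma harmonic_interp_continuous c N s : c <> 0 ->
  continuity_pt (harmonic_interp c N) s.
Proof.
intros Hc. apply continuity_pt_filterlim.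
induction N as [|N IH].
- apply (continuous_ext (fun _ => 0)).
  { intros t. symmetry. apply harmonic_interp_O. }
  apply continuous_const.
- apply (continuous_ext (fun s => harmonic_interp c N s
                             + (1 - (1 - s / c) ^ S N) / INR (S N))).
  { intros t. symmetry. apply harmonic_interp_S. }
  apply (continuous_plus (V := R_NormedModule)); [exact IH |].
  apply (ex_derive_continuous (V := R_NormedModule)). auto_derive. exact I.
Qed.

(** Such a [K] is the integral of [(1 - exp (- u)) / u], whereas the harmonic
    number is that of [(1 - (1 - u / N) ^ N) / u] up to [N].  The integrands
    differ by at most [u * exp (- u) / N], whose integral over the half-line is
    [1 / N]. *)
Lemma exp_integral_harmonic (K : R -> R) (N : nat) : (1 <= N)%nat ->
  K 0 = 0 -> (forall s, 0 <= s -> continuity_pt K s) ->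
  (forall s, 0 < s -> is_derive K s ((1 - exp (- s)) / s)) ->
  harmonic N - / INR N <= K (INR N) <= harmonic N.
Proof.
intros HN K0 Kc Kd.
assert (HN0 : 0 < INR N) by (apply lt_0_INR; lia).
(* The mean value point may be the endpoint [0], where the derivatives below are
   quotients of [0] by [0]. *)
assert (Hdiv : forall u s, 0 <= s -> (0 < s -> u <= 0) -> (s = 0 -> u = 0) ->
  u / s <= 0).
{ intros u s Hs H H0. destruct (Req_dec s 0) as [E | E].
  - rewrite (H0 E). unfold Rdiv. lra.
  - unfold Rdiv. assert (0 < / s) by (apply Rinv_0_lt_compat; lra).
    specialize (H ltac:(lra)). nra. }
rewrite <- (harmonic_interp_diag (INR N)) by lra. split.
- (* The added term is an antiderivative of [- s * exp (- s) / N]; it decreases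
     from [1 / N] to a positive value. *)
  pose (f s := harmonic_interp (INR N) N s - K s + (1 + s) * exp (- s) / INR N).
  enough (f (INR N) <= f 0) as H.
  { unfold f in H.
    rewrite K0, harmonic_interp_0, Ropp_0, exp_0 in H.
    assert (0 <= (1 + INR N) * exp (- INR N) / INR N).
    { apply Rdiv_le_0_compat; [| lra]. pose proof (exp_pos (- INR N)). nra. }
    unfold Rdiv in *. lra. }
  apply nonincreasing_of_derive with (df := fun s =>
    (exp (- s) * (1 - s ^ 2 / INR N) - (1 - s / INR N) ^ N) / s); [lra | | |].
  + intros s Hs.
    replace ((exp (- s) * (1 - s ^ 2 / INR N) - (1 - s / INR N) ^ N) / s)
      with ((1 - (1 - s / INR N) ^ N) / s - (1 - exp (- s)) / s
            + - (s * exp (- s) / INR N)) by (field; lra).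
    apply (is_derive_plus (V := R_NormedModule));
      [apply (is_derive_minus (V := R_NormedModule));
       [apply is_derive_harmonic_interp | apply Kd]; lra |].
    auto_derive; [exact I |]. field. lra.
  + intros s Hs.
    apply (continuity_pt_plus (fun s => harmonic_interp (INR N) N s - K s)
      (fun s => (1 + s) * exp (- s) / INR N));
      [apply (continuity_pt_minus (harmonic_interp (INR N) N) K);
       [apply harmonic_interp_continuous; lra | apply Kc; lra] |].
    apply continuity_pt_filterlim.
    refine (ex_derive_continuous (V := R_NormedModule)
              (fun s => (1 + s) * exp (- s) / INR N) s _).
    auto_derive. exact I.
  + intros s Hs. pose proof (exp_pow_bounds N s HN Hs).
    apply Hdiv; [lra | intros; lra |].
    intros ->. rewrite Rdiv_0_l, Rminus_0_r, pow1, Ropp_0, exp_0.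
    unfold Rdiv; simpl; ring.
- enough (K (INR N) - harmonic_interp (INR N) N (INR N)
          <= K 0 - harmonic_interp (INR N) N 0) as H
    by (rewrite K0, harmonic_interp_0 in H; lra).
  apply nonincreasing_of_derive with
    (f := fun s => K s - harmonic_interp (INR N) N s)
    (df := fun s => ((1 - s / INR N) ^ N - exp (- s)) / s); [lra | | |].
  + intros s Hs.
    replace (((1 - s / INR N) ^ N - exp (- s)) / s)
      with ((1 - exp (- s)) / s - (1 - (1 - s / INR N) ^ N) / s) by (field; lra).
    apply (is_derive_minus (V := R_NormedModule));
      [apply Kd | apply is_derive_harmonic_interp]; lra.
  + intros s Hs. apply (continuity_pt_minus K (harmonic_interp (INR N) N));
      [apply Kc; lra | apply harmonic_interp_continuous; lra].
  + intros s Hs. pose proof (exp_pow_bounds N s HN Hs).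
    apply Hdiv; [lra | intros; lra |].
    intros ->. rewrite Rdiv_0_l, Rminus_0_r, pow1, Ropp_0, exp_0. ring.
Qed.

(** * Generating functions *)

(** Summing the system gives [D - t D = - G] and [G' - t G' - G = D], where [G]
    is the series of [l] and [D] that of [d (n + 1)]; elimination of [D] leaves
    [(1 - t) ^ 2 * G' = - t * G]. *)
Lemma gf_ode l d t : laguerre_system l d -> d 0%nat = 0 ->
  (exists M, forall n, Rabs (l n) <= M) -> Rabs t < 1 ->
  is_derive (PSeries l) t (- t * PSeries l t / (1 - t) ^ 2).
Proof.
intros Hsys d0 Hb Ht.
assert (Hr : Rbar_lt (Rabs t) (CV_radius l)) by now apply CV_radius_of_bounded.
assert (t < 1) by now apply Rabs_def2 in Ht.
assert (Hder := is_derive_PSeries l t Hr).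
set (G := PSeries l t) in *. set (G' := PSeries (PS_derive l) t) in *.
assert (HG : is_pseries l t G) by (apply PSeries_correct, CV_radius_inside, Hr).
assert (HG' : is_pseries (PS_derive l) t G')
  by (apply PSeries_correct, ex_pseries_derive, Hr).
assert (HD : is_pseries (fun n => d (S n)) t (G' - t * G' - G)).
{ generalize (is_pseries_minus _ _ _ _ _
    (is_pseries_minus _ _ _ _ _ HG' (is_pseries_incr_1 _ _ _ HG')) HG).
  apply is_pseries_ext. intros n. rewrite <- (proj2 (Hsys n)).
  unfold PS_minus, PS_plus, PS_opp, PS_incr_1, PS_derive, plus, opp, zero;
    destruct n as [|n]; cbn -[INR].
  - simpl. ring.
  - rewrite (S_INR (S n)). ring. }
assert (HE : is_pseries (fun n => - l n) t
  ((G' - t * G' - G) - t * (G' - t * G' - G))).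
{ generalize (is_pseries_minus _ _ _ _ _ HD (is_pseries_incr_1 _ _ _ HD)).
  apply is_pseries_ext. intros n.
  unfold PS_minus, PS_plus, PS_opp, PS_incr_1, plus, opp, zero;
    destruct n as [|n]; cbn.
  - rewrite (proj1 (Hsys 0%nat)), d0. ring.
  - rewrite (proj1 (Hsys (S n))). ring. }
pose proof (is_pseries_unique _ _ _ (is_pseries_opp _ _ _ HG)) as E1.
pose proof (is_pseries_unique _ _ _ HE) as E2.
assert (E : (G' - t * G' - G) - t * (G' - t * G' - G) = - G)
  by (rewrite <- E2; exact E1).
replace (- t * G / (1 - t) ^ 2) with G'; [exact Hder |].
apply (Rmult_eq_reg_r ((1 - t) ^ 2)); [| apply pow_nonzero; lra].
unfold Rdiv. rewrite Rmult_assoc, Rinv_l by (apply pow_nonzero; lra).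
lra.
Qed.

Lemma gf_closed l d t : laguerre_system l d -> l 0%nat = 1 -> d 0%nat = 0 ->
  (exists M, forall n, Rabs (l n) <= M) -> 0 <= t < 1 ->
  PSeries l t = exp (- (t / (1 - t))) / (1 - t).
Proof.
intros Hsys l0 d0 Hb [Ht0 Ht1].
(* [(1 - x) * exp (x / (1 - x))] is an integrating factor of the differential
   equation. *)
pose (H x := PSeries l x * ((1 - x) * exp (x / (1 - x)))).
assert (H0 : H 0 = 1).
{ unfold H. rewrite PSeries_0, l0, Rdiv_0_l, exp_0. ring. }
assert (E : H t = 1).
{ destruct (Req_dec t 0) as [-> | Hne]; [exact H0 |].
  rewrite <- H0. symmetry. apply (eq_is_derive (V := R_NormedModule)); [| lra].
  intros x Hx.
  assert (Hax : Rabs x < 1) by (rewrite Rabs_pos_eq; lra).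
  evar_last.
  - apply (is_derive_mult _ (fun x => (1 - x) * exp (x / (1 - x))) x _
      (x * exp (x / (1 - x)) / (1 - x)) (gf_ode l d x Hsys d0 Hb Hax));
      [| apply Rmult_comm].
    auto_derive; [lra |]. unfold Rdiv, Rminus. field. lra.
  - unfold plus, mult, zero; simpl. field. lra. }
unfold H in E. rewrite exp_Ropp. pose proof (exp_pos (t / (1 - t))).
apply (Rmult_eq_reg_r ((1 - t) * exp (t / (1 - t))));
  [rewrite E; field; lra | apply Rmult_integral_contrapositive; lra].
Qed.

Lemma CV_radius_divided (l : nat -> R) :
  CV_radius (PS_Int (PS_decr_1 l)) = CV_radius l.
Proof. rewrite CV_radius_Int. apply CV_radius_decr_1. Qed.

(** In [PS_Int (PS_decr_1 l)] the coefficients are [l n / n], with [0] at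
    [n = 0]; the derivative of their series is the series of [l] without the constant term,
    divided by [t]. *)
Lemma is_derive_divided_gf l d t : laguerre_system l d -> l 0%nat = 1 ->
  d 0%nat = 0 -> (exists M, forall n, Rabs (l n) <= M) -> 0 < t < 1 ->
  is_derive (PSeries (PS_Int (PS_decr_1 l))) t
    ((exp (- (t / (1 - t))) / (1 - t) - 1) / t).
Proof.
intros Hsys l0 d0 Hb Ht.
assert (Hta : Rabs t < 1) by (rewrite Rabs_pos_eq; lra).
assert (Hr : Rbar_lt (Rabs t) (CV_radius l)) by now apply CV_radius_of_bounded.
rewrite <- (gf_closed l d t Hsys l0 d0 Hb) by lra.
rewrite (PSeries_decr_1 l) by (apply CV_radius_inside, Hr).
rewrite l0. replace ((1 + _ - 1) / t) with (PSeries (PS_decr_1 l) t)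
  by (field; lra).
rewrite (PSeries_ext (PS_decr_1 l) (PS_derive (PS_Int (PS_decr_1 l)))).
- apply is_derive_PSeries. rewrite CV_radius_divided. exact Hr.
- intros n. unfold PS_derive, PS_Int, PS_decr_1. field. apply not_0_INR. lia.
Qed.

(** The substitution [t = s / (s + 1)] has [1 - t = 1 / (s + 1)] and
    [t / (1 - t) = s].  It makes [ln (s + 1)] minus the series of [l n / n] an
    antiderivative of [(1 - exp (- s)) / s], so that the series at
    [t = N / (N + 1)] is within [1 / N] of [ln (N + 1) - harmonic N]. *)
Lemma divided_gf_bounds l d N : laguerre_system l d -> l 0%nat = 1 ->
  d 0%nat = 0 -> (exists M, forall n, Rabs (l n) <= M) -> (1 <= N)%nat ->
  ln (INR (S N)) - harmonic N
  <= PSeries (PS_Int (PS_decr_1 l)) (INR N / INR (S N))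
  <= ln (INR (S N)) - harmonic N + / INR N.
Proof.
intros Hsys l0 d0 Hb HN.
set (A := PSeries (PS_Int (PS_decr_1 l))).
pose (K s := ln (s + 1) - A (s / (s + 1))).
assert (Ht : forall s, 0 <= s -> 0 <= s / (s + 1) < 1).
{ intros s Hs. split; [apply Rdiv_le_0_compat; lra |].
  apply (Rmult_lt_reg_r (s + 1)); [lra |].
  unfold Rdiv. rewrite Rmult_assoc, Rinv_l; lra. }
assert (HK : harmonic N - / INR N <= K (INR N) <= harmonic N).
{ apply exp_integral_harmonic; [exact HN | | |].
  - unfold K, A. rewrite Rdiv_0_l, Rplus_0_l, ln_1, PSeries_0.
    unfold PS_Int. ring.
  - intros s Hs. specialize (Ht s Hs).
    apply (continuity_pt_minus (fun s => ln (s + 1)) (fun s => A (s / (s + 1)))).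
    + apply continuity_pt_filterlim.
      refine (ex_derive_continuous (V := R_NormedModule) (fun s => ln (s + 1)) s _).
      auto_derive. lra.
    + apply (continuity_pt_comp (fun s => s / (s + 1)) A).
      * apply continuity_pt_filterlim.
        refine (ex_derive_continuous (V := R_NormedModule)
                  (fun s => s / (s + 1)) s _).
        auto_derive. lra.
      * apply PSeries_continuity. rewrite CV_radius_divided.
        apply CV_radius_of_bounded; [exact Hb | rewrite Rabs_pos_eq; lra].
  - intros s Hs. specialize (Ht s ltac:(lra)).
    assert (0 < s / (s + 1)) by (apply Rdiv_lt_0_compat; lra).
    pose (dA t := (exp (- (t / (1 - t))) / (1 - t) - 1) / t).
    evar_last.
    + apply (is_derive_minus (V := R_NormedModule) (fun s => ln (s + 1))
        (fun s => A (s / (s + 1))) s (/ (s + 1))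
        (scal (/ (s + 1) ^ 2) (dA (s / (s + 1))))).
      * auto_derive; [lra | field; lra].
      * apply (is_derive_comp A (fun s => s / (s + 1)) s _ (/ (s + 1) ^ 2)).
        -- apply (is_derive_divided_gf l d); auto; lra.
        -- auto_derive; [lra | field; lra].
    + unfold dA. replace (s / (s + 1) / (1 - s / (s + 1))) with s by (field; lra).
      unfold minus, plus, opp, scal; simpl; unfold mult; simpl. field.
      repeat split; lra. }
unfold K in HK. rewrite <- S_INR in HK. unfold A in *. lra.
Qed.

Lemma ln_harmonic_lim :
  is_lim_seq (fun N => ln (INR (S N)) - harmonic N) (- Euler_gamma).
Proof.
pose proof (proj1 (is_lim_seq_incr_1 _ _) Euler_gamma_correct) as H1.
assert (H2 : is_lim_seq (fun N => / INR (S N)) 0).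
{ apply (is_lim_seq_incr_1 (fun N => / INR N)).
  apply (is_lim_seq_inv _ p_infty); [apply is_lim_seq_INR | discriminate]. }
pose proof (is_lim_seq_minus' _ _ _ _ H2 H1) as H.
rewrite Rminus_0_l in H. revert H. apply is_lim_seq_ext.
intros N. rewrite harmonic_S. ring.
Qed.

(** * The series for Euler's constant *)

Lemma Laguerre_series :
  is_series (fun n : nat => Laguerre (S n) 1 / INR (S n)) (- Euler_gamma).
Proof.
set (l n := Laguerre n 1). set (a := PS_Int (PS_decr_1 l)).
assert (Hlim : is_lim_seq l 0)
  by exact (laguerre_system_lim _ _ Laguerre_system_1).
apply (is_series_incr_1 (V := R_NormedModule) a).
change (a 0%nat) with (zero : R_NormedModule). rewrite plus_zero_r.
apply tauber.
- apply is_lim_seq_incr_1.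
  apply (is_lim_seq_ext (fun n => l (S n))).
  + intros n. unfold a, PS_Int, PS_decr_1. field. apply not_0_INR. lia.
  + now apply (is_lim_seq_incr_1 l).
- assert (Hinv : is_lim_seq (fun N => / INR N) 0)
    by (apply (is_lim_seq_inv _ p_infty); [apply is_lim_seq_INR | discriminate]).
  pose proof (is_lim_seq_plus' _ _ _ _ ln_harmonic_lim Hinv) as Hup.
  rewrite Rplus_0_r in Hup.
  refine (is_lim_seq_le_le_loc _ _ _ _ _ ln_harmonic_lim Hup).
  exists 1%nat. intros N HN.
  apply (divided_gf_bounds l (fun n => laguerre_diff n 1)).
  + exact Laguerre_system_1.
  + apply Laguerre_0.
  + apply laguerre_diff_0.
  + exact (is_lim_seq_bounded _ _ Hlim).
  + exact HN.
Qed.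

Theorem corollary2p4 :
  is_series (fun n : nat => Laguerre (S n) 1 / INR (S n)) (- Euler_gamma)
  /\ Laguerre 1 1 / INR 1 = 0
  /\ Laguerre 2 1 / INR 2 = - (1 / 4)
  /\ Laguerre 3 1 / INR 3 = - (2 / 9)
  /\ Laguerre 4 1 / INR 4 = - (5 / 32).
Proof.
split; [exact Laguerre_series |].
(* Four steps of the recurrence are linear equations that determine the
   values. *)
pose proof (Laguerre_0 1) as L0. pose proof (laguerre_diff_0 1) as D0.
pose proof (fun n => laguerre_diff_S n 1) as HD.
pose proof (fun n => Laguerre_S n 1) as HL.
pose proof (HD 0%nat); pose proof (HD 1%nat);
  pose proof (HD 2%nat); pose proof (HD 3%nat).
pose proof (HL 0%nat); pose proof (HL 1%nat);
  pose proof (HL 2%nat); pose proof (HL 3%nat).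
simpl INR in *. lra.
Qed.
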